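(* Let $\widehat{A}=A+\varepsilon B$ be an $n\times n$ dual matrix with $A,B\in\mathbb{R}^{n\times n}$ and $\mathrm{rank}(A)=r$. Then the dual index of $\widehat{A}$ is equal to one if and only if $\mathrm{Ind}(A)=1$ and $$\mathrm{rank}(A)=\mathrm{rank}\left(\begin{bmatrix}A & B(I_n-AA^{\#})\end{bmatrix}\right).$$
   Context: Dual numbers are $a+\varepsilon a'$ with $a,a'\in\mathbb{R}$ and $\varepsilon\neq 0$, $\varepsilon^2=0$ (i.e. the ring $\mathbb{R}[\varepsilon]/(\varepsilon^2)$). A dual matrix is a matrix over dual numbers, written $\widehat{A}=A+\varepsilon B$ with $A,B$ real. The range $\mathcal{R}(\widehat{A})$ of an $n\times n$ dual matrix is $\{\widehat{A}\widehat{x}: \widehat{x}$ a dual column vector of length $n\}$. The dual index of an $n\times n$ dual matrix $\widehat{A}$ is said to be equal to one, $\mathrm{Ind}(\widehat{A})=1$, if $\mathcal{R}(\widehat{A}^2)=\mathcal{R}(\widehat{A})$. For a real square matrix $A$, ''$\mathrm{Ind}(A)=1$'' means $\mathrm{rank}(A^2)=\mathrm{rank}(A)$; in that case $A^{\#}$ denotes the group inverse of $A$, i.e. the unique real $X$ with $AXA=A$, $XAX=X$, $AX=XA$. *)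

(* Defs.v *)
From HB Require Import structures.
From mathcomp Require Import all_boot all_order all_algebra.
From mathcomp Require Import boolp classical_sets reals.

Set Implicit Arguments.
Unset Strict Implicit.
Unset Printing Implicit Defensive.

Import GRing.Theory.
Local Open Scope classical_set_scope.
Local Open Scope ring_scope.

(* [DualNum a a'] is a + ε a'. *)
Record dualnum (R : Type) := DualNum { std_part : R; dual_part : R }.

Section DualNumbers.
Variable R : comNzRingType.
Implicit Types x y z : dualnum R.

Definition pair_of_dualnum x := (std_part x, dual_part x).
Definition dualnum_of_pair (p : R * R) := DualNum p.1 p.2.

Lemma pair_of_dualnumK : cancel pair_of_dualnum dualnum_of_pair.
Proof. by case. Qed.

HB.instance Definition _ := Choice.copy (dualnum R) (can_type pair_of_dualnumK).

Definition dualnum_add x y :=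
  DualNum (std_part x + std_part y) (dual_part x + dual_part y).
Definition dualnum_opp x := DualNum (- std_part x) (- dual_part x).

Lemma dualnum_addA : associative dualnum_add.
Proof. by case=> a a' [b b'] [c c']; rewrite /dualnum_add /= !addrA. Qed.
Lemma dualnum_addC : commutative dualnum_add.
Proof. by case=> a a' [b b']; congr DualNum; rewrite addrC. Qed.
Lemma dualnum_add0 : left_id (DualNum 0 0) dualnum_add.
Proof. by case=> a a'; rewrite /dualnum_add /= !add0r. Qed.
Lemma dualnum_addN : left_inverse (DualNum 0 0) dualnum_opp dualnum_add.
Proof. by case=> a a'; rewrite /dualnum_add /= !addNr. Qed.

HB.instance Definition _ := GRing.isZmodule.Build (dualnum R)
  dualnum_addA dualnum_addC dualnum_add0 dualnum_addN.

(* (a + ε a') (b + ε b') = a b + ε (a b' + a' b), as ε ^ 2 = 0. *)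
Definition dualnum_mul x y :=
  DualNum (std_part x * std_part y)
          (std_part x * dual_part y + dual_part x * std_part y).

Lemma dualnum_mulA : associative dualnum_mul.
Proof.
case=> a a' [b b'] [c c']; congr DualNum; rewrite /= ?mulrA //.
by rewrite mulrDr mulrDl !mulrA addrA.
Qed.
Lemma dualnum_mulC : commutative dualnum_mul.
Proof.
case=> a a' [b b']; congr DualNum; rewrite /= 1?mulrC //.
by rewrite addrC; congr (_ + _); rewrite mulrC.
Qed.
Lemma dualnum_mul1 : left_id (DualNum 1 0) dualnum_mul.
Proof. by case=> a a'; rewrite /dualnum_mul /= !mul1r mul0r addr0. Qed.
Lemma dualnum_mulD : left_distributive dualnum_mul +%R.
Proof.
case=> a a' [b b'] [c c']; congr DualNum; rewrite /= mulrDl //.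
by rewrite mulrDl addrACA.
Qed.
Lemma dualnum_1neq0 : DualNum 1 0 != 0 :> dualnum R.
Proof. by apply/eqP=> -[] /eqP; rewrite oner_eq0. Qed.

HB.instance Definition _ := GRing.Zmodule_isComNzRing.Build (dualnum R)
  dualnum_mulA dualnum_mulC dualnum_mul1 dualnum_mulD dualnum_1neq0.

Definition dual_eps : dualnum R := DualNum 0 1.
Definition dual_inj (a : R) : dualnum R := DualNum a 0.

Lemma dual_eps_neq0 : dual_eps != 0.
Proof. by apply/eqP=> -[] /eqP; rewrite oner_eq0. Qed.

Lemma dual_eps_sq : dual_eps ^+ 2 = 0.
Proof. by congr DualNum; rewrite /= mul0r ?mulr0 ?addr0. Qed.

Lemma dualnumE x :
  x = dual_inj (std_part x) + dual_eps * dual_inj (dual_part x).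
Proof.
by case: x => a a'; congr DualNum; rewrite /= ?mul0r ?mul1r ?addr0 ?add0r.
Qed.

Definition dual_mx m n (A B : 'M[R]_(m, n)) : 'M[dualnum R]_(m, n) :=
  map_mx dual_inj A + dual_eps *: map_mx dual_inj B.

Lemma dual_mxE m n (A B : 'M[R]_(m, n)) i j :
  dual_mx A B i j = DualNum (A i j) (B i j).
Proof. by rewrite !mxE [RHS]dualnumE. Qed.

Definition dual_range n (M : 'M[dualnum R]_n) : set 'cV[dualnum R]_n :=
  [set M *m x | x in [set: 'cV[dualnum R]_n]].

Definition dual_index_one n (M : 'M[dualnum R]_n) : Prop :=
  dual_range (M *m M) = dual_range M.

End DualNumbers.

Section GroupInverse.
Variables (F : fieldType) (n : nat).
Implicit Types A X Y : 'M[F]_n.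

Definition index_one A : Prop := \rank (A *m A) = \rank A.

Definition is_group_inverse A X : Prop :=
  [/\ A *m X *m A = A, X *m A *m X = X & A *m X = X *m A].

(* Junk value 0 when A has no group inverse. *)
Definition group_inverse A : 'M[F]_n := xget 0 [set X | is_group_inverse A X].

Lemma is_group_inverse_unique A X Y :
  is_group_inverse A X -> is_group_inverse A Y -> X = Y.
Proof.
move=> [AXA XAX AX] [AYA YAY AY].
have XAY : A *m X = A *m Y.
  have : A *m X *m (A *m Y) = A *m Y by rewrite mulmxA AXA.
  by rewrite AX AY -mulmxA (mulmxA A) AYA => ->.
by rewrite -XAX -mulmxA XAY mulmxA -AX XAY AY YAY.
Qed.

Lemma group_inverseP A : index_one A -> is_group_inverse A (group_inverse A).
Proof.
move=> rA.
have /submxP[Y AY] : (A <= A *m A)%MS.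
  by have := mxrank_leqif_sup (submxMl A A); rewrite rA => -[_ <-].
have /submxP[Z AZ] : (A^T <= A^T *m A^T)%MS.
  have := mxrank_leqif_sup (submxMl A^T A^T).
  by rewrite -trmx_mul !mxrank_tr rA => -[_ <-].
have {}AZ : A = A *m A *m Z^T by rewrite -{1}[A]trmxK AZ !trmx_mul !trmxK.
have YZ : Y *m A = A *m Z^T by rewrite {1}AZ !mulmxA -(mulmxA Y) -AY.
apply: (xgetPex 0); exists (Y *m A *m Z^T).
have AX : A *m (Y *m A *m Z^T) = A *m Z^T by rewrite YZ !mulmxA -AZ.
have XA : Y *m A *m Z^T *m A = A *m Z^T.
  by rewrite -(mulmxA Y) -YZ -mulmxA -(mulmxA Y) -AY.
have YAA : Y *m A *m A = A by rewrite -mulmxA -AY.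
split; [by rewrite AX -YZ YAA | | by rewrite AX XA].
by rewrite XA YZ mulmxA -{1}YZ !mulmxA YAA.
Qed.

End GroupInverse.

(* Main.v *)
(** The equality of ranges says that [M = M^2 Y] for some dual matrix
    [Y = Y0 + ε Y1], that is, [A = A^2 Y0] and [B = A^2 Y1 + (A B + B A) Y0].
    The first equation forces [Ind(A) = 1] and [A Y0 = A A^#].  Let
    [Q = I - A A^#].  Multiplying the second equation by [Q] on both sides
    leaves [Q B Q = 0], i.e. [B Q = A (A^# B Q)], which is the rank condition.
    Conversely, if [Q B Q = 0], then [Y0 = A^#] and
    [Y1 = A^# A^# B Q - A^# B A^#] solve both equations. *)
Require Import Defs.
From mathcomp Require Import all_boot all_order all_algebra.
From mathcomp Require Import boolp classical_sets reals.

Set Implicit Arguments.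
Unset Strict Implicit.
Unset Printing Implicit Defensive.

Import GRing.Theory.
Local Open Scope ring_scope.

Section DualMatrices.
Variable R : comNzRingType.

Lemma std_part_sum (I : finType) (F : I -> dualnum R) :
  std_part (\sum_i F i) = \sum_i std_part (F i).
Proof. exact: (big_morph (@std_part R) (fun x y => erefl) erefl). Qed.

Lemma dual_part_sum (I : finType) (F : I -> dualnum R) :
  dual_part (\sum_i F i) = \sum_i dual_part (F i).
Proof. exact: (big_morph (@dual_part R) (fun x y => erefl) erefl). Qed.

Lemma dualnum_eq (x y : dualnum R) :
  std_part x = std_part y -> dual_part x = dual_part y -> x = y.
Proof. by case: x y => a a' [b b'] /= -> ->. Qed.

Lemma mul_dual_mx m n p (A B : 'M[R]_(m, n)) (C D : 'M[R]_(n, p)) :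
  dual_mx A B *m dual_mx C D = dual_mx (A *m C) (A *m D + B *m C).
Proof.
apply/matrixP=> i j; rewrite dual_mxE !mxE -big_split /=.
apply: dualnum_eq; rewrite /= ?std_part_sum ?dual_part_sum.
  by apply: eq_bigr => k _; rewrite !dual_mxE.
by apply: eq_bigr => k _; rewrite !dual_mxE.
Qed.

Lemma dual_mx_inj m n (A B C D : 'M[R]_(m, n)) :
  dual_mx A B = dual_mx C D -> A = C /\ B = D.
Proof.
move=> /matrixP eqM.
by split; apply/matrixP=> i j; have := eqM i j; rewrite !dual_mxE => -[].
Qed.

Lemma dual_mx_eta m n (M : 'M[dualnum R]_(m, n)) :
  M = dual_mx (map_mx (@std_part R) M) (map_mx (@dual_part R) M).
Proof. by apply/matrixP=> i j; rewrite dual_mxE !mxE; case: (M i j). Qed.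

(** The range of [M *m M] always lies in that of [M]. For the other inclusion it suffices to reach
    each column of [M]; the chosen preimages are the columns of [Y]. *)
Lemma dual_index_oneP n (M : 'M[dualnum R]_n) :
  dual_index_one M <-> exists Y, M = M *m M *m Y.
Proof.
split=> [eqr | [Y MY]].
  have colM j : exists y, M *m M *m y = col j M.
    have : dual_range M (col j M) by exists (delta_mx j 0); rewrite ?colE.
    by rewrite -eqr => -[y _ yE]; exists y.
  have [y yE] := choice colM.
  exists (\matrix_(i, j) y j i 0); apply/matrixP=> i j.
  have /matrixP/(_ i 0) := yE j; rewrite !mxE => <-.
  by apply: eq_bigr => k _; rewrite [in RHS]mxE.
apply/seteqP; split=> _ [x _ <-].
  by exists (M *m x); rewrite ?mulmxA.
by exists (Y *m x); rewrite // mulmxA -MY.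
Qed.

Lemma dual_index_one_dual_mxP n (A B : 'M[R]_n) :
  dual_index_one (dual_mx A B) <->
  exists Y0 Y1, A = A *m A *m Y0 /\
                B = A *m A *m Y1 + (A *m B + B *m A) *m Y0.
Proof.
rewrite dual_index_oneP; split=> [[Y]|[Y0 [Y1 [AE BE]]]].
  rewrite (dual_mx_eta Y) !mul_dual_mx => /dual_mx_inj[AE BE].
  by exists (map_mx (@std_part R) Y), (map_mx (@dual_part R) Y).
by exists (dual_mx Y0 Y1); rewrite !mul_dual_mx -AE -BE.
Qed.

End DualMatrices.

Section Rank.
Variable F : fieldType.

(** Appending columns preserves the rank exactly when they lie in the column space of [A].
    Transposing turns this into an inclusion of row spaces, which is what [<=] in [%MS] compares. *)
Lemma rank_row_mxP m n p (A : 'M[F]_(m, n)) (C : 'M[F]_(m, p)) :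
  \rank A = \rank (row_mx A C) <-> exists Z, C = A *m Z.
Proof.
have sub : (A^T <= col_mx A^T C^T)%MS by rewrite -addsmxE addsmxSl.
rewrite -mxrank_tr -(mxrank_tr (row_mx A C)) tr_row_mx.
have [_ rkE] := mxrank_leqif_sup sub.
split=> [/eqP | [Z CE]].
  rewrite rkE col_mx_sub => /andP[_ /submxP[Z CE]].
  by exists Z^T; rewrite -[C]trmxK CE trmx_mul trmxK.
by apply/eqP; rewrite rkE col_mx_sub submx_refl CE trmx_mul submxMl.
Qed.

Lemma index_oneP n (A : 'M[F]_n) :
  index_one A <-> exists Y, A = A *m A *m Y.
Proof.
split=> [/group_inverseP[AXA _ AX] | [Y AE]].
  by exists (group_inverse A); rewrite -mulmxA AX mulmxA AXA.
by apply/eqP; rewrite eqn_leq mxrankM_maxl {1}AE mxrankM_maxl.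
Qed.

End Rank.

Theorem theorem2p1 (R : realType) (n r : nat) (A B : 'M[R]_n)
    (rankA : \rank A = r) :
  dual_index_one (dual_mx A B) <->
  index_one A /\
  \rank A = \rank (row_mx A (B *m (1%:M - A *m group_inverse A))).
Proof.
rewrite dual_index_one_dual_mxP rank_row_mxP.
set X := group_inverse A; set Q := 1%:M - A *m X.
split=> [[Y0 [Y1 [AE BE]]] | [indA [Z BQ]]].
  have indA : index_one A by apply/index_oneP; exists Y0.
  split=> //; have [AXA _ AX] := group_inverseP indA.
  rewrite -/X in AXA AX.
  have QA : Q *m A = 0 by rewrite mulmxBl mul1mx AXA subrr.
  (* Here [A X = X A = X A A Y0 = A X A Y0 = A Y0]. *)
  have AY0 : A *m Y0 = A *m X by rewrite AX {2}AE !mulmxA -AX AXA.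
  have PQ : A *m X *m Q = 0 by rewrite mulmxBr mulmx1 mulmxA AXA subrr.
  have QBQ : Q *m (B *m Q) = 0.
    (* Since [Q A = 0], left multiplication of [BE] by [Q] leaves only the term [B A Y0]. *)
    have QB : Q *m B = Q *m B *m (A *m Y0).
      clearbody Q; rewrite [in LHS]BE mulmxDl !mulmxDr !mulmxA.
      by rewrite QA !mul0mx !add0r.
    by rewrite mulmxA QB AY0 -mulmxA PQ mulmx0.
  (* The difference of the two sides is [(1 - A X) B Q = Q B Q]. *)
  exists (X *m (B *m Q)); apply/eqP; rewrite -subr_eq0; apply/eqP.
  by rewrite mulmxA -[X in X - _]mul1mx -mulmxBl.
have [AXA _ AX] := group_inverseP indA; rewrite -/X in AXA AX.
have AAX : A *m A *m X = A by rewrite -mulmxA AX mulmxA AXA.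
exists X, (X *m X *m (B *m Q) - X *m B *m X); split=> //.
(* As [B Q = A Z], also [A X B Q = A X A Z = B Q], so [A A Y1 = B Q - A B X]. Adding [A B X + B A X]
   gives [B (Q + A X) = B]. *)
rewrite mulmxBr !mulmxA AAX -[A *m X *m B *m Q]mulmxA BQ mulmxA AXA -BQ.
by rewrite mulmxDl addrA subrK -mulmxA -mulmxDr subrK mulmx1.
Qed.
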